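(* For every integer $n\ge1$ and every poset $\mathcal{T}=(T,\preccurlyeq)$ with $T=\{1,\ldots,n\}$, the class $\overrightarrow{\mathbf{P}}^{\mathit{fin}}_{\mathcal{T}}$ has the ordering property.
   Context: Let $\mathcal{T}=(\{1,\ldots,n\},\preccurlyeq)$ be a poset (a template). A structure $(A,\sqsubseteq_1,\ldots,\sqsubseteq_n)$ consisting of $n$ partial orders on a set $A$ conforms to $\mathcal{T}$ if $(\sqsubseteq_i)\subseteq(\sqsubseteq_j)$ whenever $i\preccurlyeq j$ in $\mathcal{T}$, and is consistent if there is a linear order on $A$ which extends each $\sqsubseteq_i$, $1\le i\le n$. (A linear order $<$ extends a partial order $\sqsubseteq$ if $a\sqsubseteq b$ and $a\neq b$ imply $a<b$.) $\mathbf{P}_{\mathcal{T}}$ is the class of all structures $(A,\sqsubseteq_1,\ldots,\sqsubseteq_n)$ consisting of $n$ partial orders which conform to $\mathcal{T}$ and are consistent. $\overrightarrow{\mathbf{P}}_{\mathcal{T}}$ is the class of all structures $(A,\sqsubseteq_1,\ldots,\sqsubseteq_n,<)$ such that $(A,\sqsubseteq_1,\ldots,\sqsubseteq_n)\in\mathbf{P}_{\mathcal{T}}$ and $<$ is a linear order on $A$ which extends each $\sqsubseteq_i$. The superscript $\mathit{fin}$ denotes the subclass of finite structures. Embeddings are injective maps preserving and reflecting all the relations; $\hookrightarrow$ denotes embeddability. Ordering property. Let $\mathbf{K}^*$ be a class of finite structures of the form $(\mathcal{A},<)$ with $<$ a linear order on $A$, and let $\mathbf{K}=\{\mathcal{A}:(\mathcal{A},<)\in\mathbf{K}^*\}$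 be the class of reducts obtained by forgetting $<$. $\mathbf{K}^*$ has the ordering property if for every $\mathcal{A}\in\mathbf{K}$ there is $\mathcal{B}\in\mathbf{K}$ such that $(\mathcal{A},<)\hookrightarrow(\mathcal{B},\sqsubset)$ for every linear order $<$ on $A$ with $(\mathcal{A},<)\in\mathbf{K}^*$ and every linear order $\sqsubset$ on $B$ with $(\mathcal{B},\sqsubset)\in\mathbf{K}^*$. *)

(* Defs.v *)
(* MathComp (ssreflect).  The index set {1, ..., n} is rendered as 'I_n. *)
From mathcomp Require Import all_boot.

Set Implicit Arguments.
Unset Strict Implicit.
Unset Printing Implicit Defensive.

Definition partial_order (A : Type) (r : rel A) : Prop :=
  [/\ reflexive r, antisymmetric r & transitive r].

(* Linear orders are strict, since "extends" below only constrains pairs of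
   distinct points. *)
Definition linear_order (A : Type) (lt : rel A) : Prop :=
  [/\ irreflexive lt, transitive lt & forall x y, x <> y -> lt x y \/ lt y x].

Definition extends (A : Type) (lt le : rel A) : Prop :=
  forall x y, le x y -> x <> y -> lt x y.

(* A finite (possibly empty) set with n binary relations; MathComp's
   bool-valued relations cover all relations on a finite set. *)
Record fin_structure (n : nat) : Type := FinStructure {
  carrier :> finType;
  rels : 'I_n -> rel carrier
}.
Arguments rels {n} A i : rename.

Definition conforms (n : nat) (T : rel 'I_n) (A : fin_structure n) : Prop :=
  forall i j, T i j -> subrel (rels A i) (rels A j).

Definition consistent (n : nat) (A : fin_structure n) : Prop :=
  exists2 lt : rel A, linear_order lt & forall i, extends lt (rels A i).

Definition P_fin (n : nat) (T : rel 'I_n) (A : fin_structure n) : Prop :=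
  [/\ forall i, partial_order (rels A i), conforms T A & consistent A].

(* A class of structures (A, <) whose last relation is the order <. *)
Definition ordered_class (n : nat) : Type :=
  forall A : fin_structure n, rel A -> Prop.

Definition ordP_fin (n : nat) (T : rel 'I_n) : ordered_class n :=
  fun A lt =>
    [/\ P_fin T A, linear_order lt & forall i, extends lt (rels A i)].

Definition ordered_embeds (n : nat) (A : fin_structure n) (ltA : rel A)
    (B : fin_structure n) (ltB : rel B) : Prop :=
  exists f : A -> B,
    [/\ injective f,
        forall i, {mono f : x y / rels A i x y >-> rels B i x y}
      & {mono f : x y / ltA x y >-> ltB x y}].

Definition reducts (n : nat) (K : ordered_class n) (A : fin_structure n) :
  Prop := exists lt : rel A, K A lt.

Definition ordering_property (n : nat) (K : ordered_class n) : Prop :=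
  forall A : fin_structure n, reducts K A ->
  exists2 B : fin_structure n, reducts K B &
    forall (ltA : rel A) (ltB : rel B),
      linear_order ltA -> K A ltA -> linear_order ltB -> K B ltB ->
      ordered_embeds ltA ltB.

(* Main.v *)
Require Import Defs.
From mathcomp Require Import all_boot.
From mathcomp Require Import zify.

Set Implicit Arguments.
Unset Strict Implicit.
Unset Printing Implicit Defensive.

(** Fix A.  The witness B has points (g, a, X), where g grades A, a is a point
of A, and X is a set of pairs (j, y) with j an index of a partial order and
y < N a position.  Two points with the same grading satisfy
(g, a, X) <=_k (g, b, Y) when g b < g a and X_j is included in Y_j for all j
above k in T, where X_j is the slice of X at j.  Inclusion makes these
relations transitive, quantifying over all j above k makes them conform to T,
and the strict descent of g makes them consistent.

A linear order < on A is encoded by the grading v a = number of points above a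
([corank]); letting g range over all gradings makes one B serve every order on
A.  Let M = #|A| + 1.  Each increasing sequence t of 2^M positions carries a
copy of A: label the index i > 0 by the point x with v x = logn 2 i, and send a
to (v, a, X) where X_j consists of the positions whose label is <=_j a.  Then
X_j(a) is included in X_j(b) exactly when a <=_j b, so this is an embedding of
the unordered structure ([copy_rels]).

Suppose a linear extension <_B of B misorders some pair of every copy; colour
t by such a pair (a, b), with a < b in A and copy b <_B copy a.  A Ramsey
argument ([monochromatic_windows]) yields a long increasing sequence all of
whose windows of length 2^M have the same colour (a, b).  By the pattern of
2-adic valuations, moving by d = 2^(v b) in either direction turns an index
whose label is <= a into an index labelled b.  For the windows w_0 and w_d at
offsets 0 and d this says that copy w_0 a is below copy w_d b and copy w_d a is
below copy w_0 b in every relation of B ([copy_shift]), whence the cycle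
  copy w_0 b <_B copy w_0 a <_B copy w_d b <_B copy w_d a <_B copy w_0 b.
So some copy has no misordered pair, and it is the required embedding. *)

(** * Monochromatic windows of increasing sequences *)

(** Shift graphs have unbounded chromatic number.  A colouring of
(K+1)-tuples induces one of K-tuples: the set of colours of the one-point
extensions to the right.  If two consecutive K-tuples have the same set, the
colour of their union is also that of an extension of the second one. *)
Lemma shift_graph (K : nat) (C : finType) : exists N, forall c : seq nat -> C,
  exists x u, [/\ size u = K.+1, path ltn x u, all (gtn N) (x :: u)
                & c (belast x u) = c u].
Proof.
elim: K C => [|K IHK] C.
  exists #|C|.+1 => c.
  pose c1 (i : 'I_#|C|.+1) := c [:: val i].
  suff [i [j [ltij eqc]]] : exists i j : 'I_#|C|.+1, i < j /\ c1 i = c1 j.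
    by exists i, [:: val j]; rewrite /= ltij !ltn_ord.
  have /injectivePn[i [j neqij eqc]] : ~~ injectiveb c1.
    by apply/injectiveP => /leq_card; rewrite card_ord ltnn.
  move: neqij; rewrite -val_eqE neq_ltn => /orP[] lt.
    by exists i, j.
  by exists j, i.
have [N IHN] := IHK {set C}.
exists N => c.
pose ext u :=
  [set z | [exists y : 'I_N, (last 0 u < y) && (c (rcons u y) == z)]].
have [x [u [size_u path_u bnd_u eq_ext]]] := IHN ext.
have: c (x :: u) \in ext u.
  rewrite -eq_ext inE; case/lastP: u size_u path_u bnd_u {eq_ext} => // u z _.
  rewrite rcons_path -rcons_cons all_rcons belast_rcons.
  move=> /andP[_ lt_z] /andP[z_bnd _].
  by apply/existsP; exists (Ordinal z_bnd); rewrite /= eqxx andbT.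
rewrite inE => /existsP[y /andP[lt_y /eqP eq_c]].
exists x, (rcons u y); split.
- by rewrite size_rcons size_u.
- by rewrite rcons_path path_u; case: u size_u lt_y {path_u bnd_u eq_ext eq_c}.
- by rewrite -rcons_cons all_rcons bnd_u andbT /=.
- by rewrite belast_rcons eq_c.
Qed.

Section MonochromaticRun.
Variables (N : nat) (C : finType) (c : seq nat -> C) (z : C).

(** The tuple [u] starts a run of length [l] when it has a right continuation
in which the first [l] windows, one longer than [u], have colour [z].  It is
boolean so that a tuple can be coloured by the finite set of its runs. *)
Fixpoint run (l : nat) (u : seq nat) : bool :=
  if l is l'.+1 then
    [exists y : 'I_N, [&& last 0 u < y, c (rcons u y) == z
                        & run l' (behead (rcons u y))]]
  else true.

Lemma run_path (K l : nat) (u : seq nat) :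
    size u = K.+1 -> sorted ltn u -> all (gtn N) u -> run l u ->
  exists s, [/\ size s = l, sorted ltn (u ++ s), all (gtn N) (u ++ s)
    & forall i, i < l -> c (take K.+2 (drop i (u ++ s))) = z].
Proof.
elim: l u => [|l IHl] [|x u] //= size_u path_u bnd_u.
  by exists [::]; rewrite /= cats0.
case/existsP=> y /and3P[lt_y /eqP eq_c run_u].
have path_y : path ltn x (rcons u y) by rewrite rcons_path path_u.
have bnd_y : all (gtn N) (rcons u y).
  by rewrite all_rcons /= ltn_ord; case/andP: bnd_u.
have [||||s [size_s path_s bnd_s mono_s]] := IHl (rcons u y).
- by rewrite size_rcons.
- exact: path_sorted path_y.
- by [].
- by [].
exists (val y :: s); rewrite -cat_rcons /=; split=> //.
- by rewrite size_s.
- rewrite cat_path path_y last_rcons /=.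
  by move: path_s; rewrite cat_rcons => /cat_sorted2[].
- by rewrite bnd_s; case/andP: bnd_u => ->.
case=> [_|i]; last exact: mono_s.
rewrite -eq_c drop0 -cat_cons take_size_cat //=.
by rewrite size_rcons; case: size_u => ->.
Qed.
End MonochromaticRun.

(** Colour a tuple by the runs of length at most L+1 that it starts.  When two
consecutive tuples have the same runs, those of the colour z of their union
can be prolonged at the front: a run of length l from the second is one of
length l+1 from the first, hence also from the second. *)
Lemma monochromatic_windows (K L : nat) (C : finType) : exists N,
  forall c : seq nat -> C, exists z s,
    [/\ size s = K.+2 + L, sorted ltn s, all (gtn N) s
      & forall i, i <= L -> c (take K.+2 (drop i s)) = z].
Proof.
have [N shiftN] := shift_graph K {set C * 'I_L.+2}.
exists N => c.
pose runs u := [set p : C * 'I_L.+2 | run N c p.1 p.2 u].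
have [x [u [size_u path_u bnd_u eq_runs]]] := shiftN runs.
have run_u l : l < L.+2 -> run N c (c (x :: u)) l u.
  elim: l => // l IHl lt_l.
  suff: (c (x :: u), Ordinal lt_l) \in runs u by rewrite inE.
  rewrite -eq_runs inE /=; apply/existsP.
  have lt_last : last x u < N.
    by move/allP: bnd_u; apply; apply: mem_last.
  exists (Ordinal lt_last); rewrite /= -lastI eqxx (IHl (ltnW lt_l)) !andbT.
  case/lastP: u size_u path_u {bnd_u eq_runs IHl lt_last} => // u y _.
  by rewrite rcons_path belast_rcons last_rcons => /andP[].
have [|s [size_s path_s bnd_s mono_s]] :=
  run_path size_u (path_sorted path_u) _ (run_u L.+1 (ltnSn _)).
  by case/andP: bnd_u.
exists (c (x :: u)), (u ++ s); split=> //.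
by rewrite size_cat size_u size_s addnS.
Qed.

(** * The ruler pattern and coranks *)

Lemma logn2_odd (e q : nat) : odd q -> logn 2 (2 ^ e * q) = e.
Proof.
move=> odd_q; have q_gt0 : 0 < q by case: q odd_q.
rewrite lognM ?expn_gt0 // pfactorK // logn_coprime ?addn0 //.
by rewrite coprime2n.
Qed.

(** In the sequence of 2-adic valuations of 1, ..., 2^M - 1, every index of
valuation greater than e has neighbours of valuation e at distance 2^e on both
sides, because it is an even multiple of 2^e. *)
Lemma ruler_shift (M e i : nat) :
    0 < i < 2 ^ M -> e < logn 2 i -> e < M ->
  [/\ 2 ^ e < i, i + 2 ^ e < 2 ^ M, logn 2 (i - 2 ^ e) = e
    & logn 2 (i + 2 ^ e) = e].
Proof.
case/andP=> i_gt0 lt_i lt_e lt_M.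
have /dvdnP[t def_i] : 2 ^ e.+1 %| i by rewrite pfactor_dvdn.
have /dvdnP[w def_M] : 2 ^ e.+1 %| 2 ^ M by rewrite dvdn_exp2l.
have e_gt0 : 0 < 2 ^ e by rewrite expn_gt0.
have t_gt0 : 0 < t by case: t def_i i_gt0 => // ->.
have lt_t : t < w by move: lt_i; rewrite def_M def_i ltn_pmul2r ?expn_gt0.
rewrite def_M def_i expnS; split; [nia|nia| |].
  rewrite (_ : _ - _ = 2 ^ e * (t.*2.-1)); last by nia.
  apply: logn2_odd; case: t t_gt0 {def_i lt_t} => //= t _.
  by rewrite odd_double.
rewrite (_ : _ + _ = 2 ^ e * (t.*2.+1)); last by nia.
by apply: logn2_odd; rewrite /= odd_double.
Qed.

Section CoRank.
Variables (A : finType) (lt : rel A).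
Hypothesis lt_linear : linear_order lt.

(** The count runs upwards so that lower points get larger 2-adic valuations:
the indices labelled by a point then separate and flank all those labelled by
points below it. *)
Definition corank (a : A) : 'I_#|A|.+1 :=
  Ordinal (max_card [pred x | lt a x] : _ < #|A|.+1).

Lemma corank_lt (a b : A) : lt a b = (corank b < corank a).
Proof.
have [irr trans total] := lt_linear.
have mono x y : lt x y -> corank y < corank x.
  move=> lt_xy; apply: proper_card; apply/properP; split.
    by apply/subsetP => z; rewrite !inE; apply: trans.
  by exists y; rewrite !inE ?irr.
apply/idP/idP => [/mono //|lt_ba].
have [eq_ab|/eqP neq_ab] := eqVneq a b; first by rewrite eq_ab ltnn in lt_ba.
have [//|/mono lt_ab] := total a b neq_ab.
by have := ltn_trans lt_ab lt_ba; rewrite ltnn.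
Qed.

Lemma corank_inj : injective corank.
Proof.
move=> a b eq_ab; have [_ _ total] := lt_linear.
case: (eqVneq a b) => // /eqP neq_ab.
by case: (total a b neq_ab); rewrite corank_lt eq_ab ltnn.
Qed.
End CoRank.

(** * The structure forcing an order *)

Section ForcingStructure.
Variables (n : nat) (T : rel 'I_n) (A : fin_structure n) (N : nat).
Hypothesis T_poset : partial_order T.

Definition forcing_point : finType :=
  ({ffun A -> 'I_#|A|.+1} * A * {set 'I_n * 'I_N})%type.

Definition forcing_rel (k : 'I_n) : rel forcing_point :=
  fun p q => (p == q) ||
    [&& p.1.1 == q.1.1, p.1.1 q.1.2 < p.1.1 p.1.2
      & [set e in p.2 | T k e.1] \subset q.2].

Definition forcing_structure : fin_structure n := FinStructure forcing_rel.

Definition forcing_lt : rel forcing_structure := fun p q =>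
  (p.1.1 p.1.2 > q.1.1 q.1.2) ||
  ((p.1.1 p.1.2 == q.1.1 q.1.2) && (enum_rank p < enum_rank q)).

Lemma forcing_lt_linear : linear_order forcing_lt.
Proof.
split=> [p|q p r|p q neq_pq]; rewrite /forcing_lt.
- by rewrite !ltnn andbF.
- rewrite -!val_eqE /=; lia.
have: enum_rank p != enum_rank q by rewrite (inj_eq enum_rank_inj); apply/eqP.
rewrite -!val_eqE /=; lia.
Qed.

Lemma forcing_lt_extends k : extends forcing_lt (rels forcing_structure k).
Proof.
move=> p q /orP[/eqP//|/and3P[/eqP eq_g lt_pq _]] _.
by rewrite /forcing_lt -eq_g lt_pq.
Qed.

Lemma forcing_rel_partial_order k : partial_order (rels forcing_structure k).
Proof.
have [T_refl _ _] := T_poset.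
split=> [p|p q|q p r] /=; rewrite /forcing_rel ?eqxx //.
  case/andP=> /orP[/eqP//|/and3P[/eqP-> lt_pq _]].
  case/orP=> [/eqP//|/and3P[_ lt_qp _]].
  by have := ltn_trans lt_pq lt_qp; rewrite ltnn.
case/orP=> [/eqP->//|/and3P[/eqP eq_pq lt_pq sub_pq]].
case/orP=> [/eqP<-|/and3P[/eqP eq_qr lt_qr sub_qr]].
  by rewrite eq_pq eqxx -eq_pq lt_pq sub_pq orbT.
apply/orP; right; rewrite eq_pq eq_qr eqxx /=; apply/andP; split.
  by rewrite -eq_qr (ltn_trans lt_qr) // -eq_pq.
apply: subset_trans sub_qr; apply/subsetP => e; rewrite !inE => /andP[pe ke].
by rewrite ke andbT; apply: (subsetP sub_pq); rewrite inE pe.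
Qed.

Lemma forcing_structure_ordP : ordP_fin T forcing_lt.
Proof.
split; [split|exact: forcing_lt_linear|exact: forcing_lt_extends].
- exact: forcing_rel_partial_order.
- have [_ _ T_trans] := T_poset.
  move=> i j Tij p q /orP[/eqP->|/and3P[eq_g lt_g sub_i]].
    by rewrite /= /forcing_rel eqxx.
  apply/orP; right; rewrite eq_g lt_g /=; apply: subset_trans sub_i.
  by apply/subsetP => e; rewrite !inE => /andP[-> /(T_trans _ _ _ Tij)].
- by exists forcing_lt; [exact: forcing_lt_linear|exact: forcing_lt_extends].
Qed.

(** * Copies along increasing sequences *)

Section Copies.
Variable lt : rel A.
Hypotheses (A_P : P_fin T A) (lt_linear : linear_order lt).
Hypothesis lt_extends : forall i, extends lt (rels A i).
Let M := #|A|.+1.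
Let v := corank lt.

Definition copy_set (t : seq nat) (a : A) : {set 'I_n * 'I_N} :=
  [set p : 'I_n * 'I_N | [exists x : A, exists i : 'I_(2 ^ M),
    [&& rels A p.1 x a, 0 < i, logn 2 i == v x & nth 0 t i == p.2]]].

Definition copy (t : seq nat) (a : A) : forcing_structure :=
  ([ffun x => v x], a, copy_set t a).

Lemma copy_inj t : injective (copy t).
Proof. by move=> a b []. Qed.

Lemma copy_setP (t : seq nat) (a : A) (j : 'I_n) (y : 'I_N) :
  reflect (exists x i, [/\ rels A j x a, 0 < i < 2 ^ M, logn 2 i = v x
                         & nth 0 t i = y])
          ((j, y) \in copy_set t a).
Proof.
rewrite inE; apply: (iffP existsP) => [[x /existsP[i]]|[x [i]]].
  case/and4P=> /= le_xa i_gt0 /eqP eq_v /eqP eq_y.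
  by exists x, i; rewrite i_gt0 ltn_ord.
case=> le_xa /andP[i_gt0 lt_i] eq_v eq_y.
exists x; apply/existsP; exists (Ordinal lt_i).
by rewrite /= le_xa i_gt0 eq_v eq_y !eqxx.
Qed.

(** The slice of [copy_set t a] at [i] contains the position with index
[2 ^ v a], whose only label is [a]; if it is also in the slice for [b], then
[a] is below [b].  The converse is transitivity of the relations above [i] in
[T], all of which contain the [i]-th. *)
Lemma copy_rels t i : size t = 2 ^ M -> sorted ltn t -> all (gtn N) t ->
  {mono copy t : a b / rels A i a b >-> rels forcing_structure i a b}.
Proof.
move=> size_t sorted_t bnd_t a b; have [A_po A_conf _] := A_P.
have [T_refl _ _] := T_poset; have [refl_i _ _] := A_po i.
rewrite /= /forcing_rel (inj_eq (@copy_inj t)) /= eqxx /=.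
case: eqVneq => [->|neq_ab] /=; first by rewrite refl_i.
rewrite !ffunE; apply/idP/idP => [/andP[lt_v sub]|le_ab].
  have lt_a : 2 ^ v a < 2 ^ M by rewrite ltn_exp2l // ltn_ord.
  have lt_N : nth 0 t (2 ^ v a) < N.
    by move/allP: bnd_t; apply; rewrite mem_nth ?size_t.
  have: (i, Ordinal lt_N) \in copy_set t b.
    apply: (subsetP sub); rewrite inE T_refl andbT; apply/copy_setP.
    by exists a, (2 ^ v a); rewrite expn_gt0 lt_a pfactorK.
  case/copy_setP=> x [k [le_xb /andP[_ lt_k] eq_v /= /eqP eq_k]].
  have t_uniq : uniq t := sorted_uniq ltn_trans ltnn sorted_t.
  move: eq_k; rewrite nth_uniq ?size_t // => /eqP eq_k.
  move: eq_v; rewrite eq_k pfactorK // => eq_v.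
  by have/(corank_inj lt_linear)-> : v a = v x by apply: val_inj.
rewrite -corank_lt // (lt_extends le_ab (elimN eqP neq_ab)) /=.
apply/subsetP => -[j y]; rewrite inE => /andP[/copy_setP[x [k]]].
case=> le_xa k_lt eq_v eq_y Tij; apply/copy_setP; exists x, k; split=> //.
have [_ _ trans_j] := A_po j.
exact: trans_j le_xa (A_conf _ _ Tij _ _ le_ab).
Qed.

(** A shift by [2 ^ v b] turns every index with a label at most [a] into one
labelled [b].  This holds for every index [j] of a partial order at once, so
the two images are related whatever the relation between [a] and [b] in [A]. *)
Lemma copy_shift (s : seq nat) (k : 'I_n) (a b : A) (d := 2 ^ v b)
    (w := fun i => take (2 ^ M) (drop i s)) :
    lt a b ->
  rels forcing_structure k (copy (w 0) a) (copy (w d) b) /\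
  rels forcing_structure k (copy (w d) a) (copy (w 0) b).
Proof.
move=> lt_ab; have [A_po _ _] := A_P; have [irr trans _] := lt_linear.
have lt_v : v b < v a by rewrite -corank_lt.
have lt_label x j i : rels A j x a -> logn 2 i = v x -> v b < logn 2 i.
  move=> le_xa ->; apply: leq_trans lt_v _; rewrite leqNgt -corank_lt //.
  apply/negP => lt_ax.
  have neq_xa : x <> a by move=> eq_xa; rewrite eq_xa irr in lt_ax.
  by have := trans _ _ _ lt_ax (lt_extends le_xa neq_xa); rewrite irr.
have le_bb j : rels A j b b by have [refl_j _ _] := A_po j.
have nth_w l i : i < 2 ^ M -> nth 0 (w l) i = nth 0 s (l + i).
  by move=> lt_i; rewrite nth_take // nth_drop.
suff sub j y : ((j, y) \in copy_set (w 0) a -> (j, y) \in copy_set (w d) b) /\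
               ((j, y) \in copy_set (w d) a -> (j, y) \in copy_set (w 0) b).
  split; apply/orP; right; rewrite /= eqxx !ffunE lt_v /=;
    apply/subsetP => -[j y]; rewrite inE => /andP[in_a _];
    by have [sub0 subd] := sub j y; auto.
split=> /copy_setP[x [i [le_xa i_bnd eq_v eq_y]]]; apply/copy_setP; exists b;
  have lt_e := lt_label _ _ _ le_xa eq_v;
  have [lt_d add_d eq_sub eq_add] := ruler_shift i_bnd lt_e (ltn_ord _);
  case/andP: i_bnd => i_gt0 i_lt.
- have sub_lt : i - d < 2 ^ M := leq_ltn_trans (leq_subr d i) i_lt.
  exists (i - d); rewrite subn_gt0 lt_d sub_lt; split=> //.
  by rewrite -eq_y !nth_w // subnKC // ltnW.
exists (i + d); rewrite addn_gt0 i_gt0 add_d; split=> //.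
by rewrite -eq_y !nth_w // add0n addnC.
Qed.

End Copies.
End ForcingStructure.

(** * The ordering property *)

Theorem corollary4p2 (n : nat) (n_gt0 : 0 < n) (T : rel 'I_n)
    (T_poset : partial_order T) : ordering_property (ordP_fin T).
Proof.
move=> A [_ [A_P _ _]].
set M := #|A|.+1.
have [N windowsN] := monochromatic_windows (2 ^ M).-2 (2 ^ M) (option (A * A)).
have def_M : (2 ^ M).-2.+2 = 2 ^ M.
  have: 1 < 2 ^ M by rewrite (@ltn_exp2l 2 0).
  by case: (2 ^ M) => [|[]].
rewrite def_M in windowsN.
exists (forcing_structure T A N).
  by exists (@forcing_lt _ T A N); apply: forcing_structure_ordP.
move=> ltA ltB ltA_linear [_ _ ltA_ext] ltB_linear [_ _ ltB_ext].
have [irrB transB totalB] := ltB_linear.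
have [irrA _ totalA] := ltA_linear.
pose f := @copy n T A N ltA.
pose misordered t (e : A * A) := ltA e.1 e.2 && ~~ ltB (f t e.1) (f t e.2).
have [z [s [size_s sorted_s bnd_s mono_s]]] :=
  windowsN (fun t => [pick e | misordered t e]).
pose w i := take (2 ^ M) (drop i s).
have := mono_s 0 isT; case: pickP => [[a b] /andP[/= lt_ab _] def_z|ordered _].
  (* One misordered pair is reversed in all windows, which closes a cycle
     through the windows at offsets 0 and [d]. *)
  have reversed i : i <= 2 ^ M -> ltB (f (w i) b) (f (w i) a).
    move/mono_s; rewrite -def_z; case: pickP => // e + [eq_e].
    rewrite eq_e => /andP[_ /= /negP not_lt].
    have neq_ab : f (w i) a <> f (w i) b.
      by case=> eq_ab _; rewrite eq_ab irrA in lt_ab.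
    by have [/not_lt|] := totalB _ _ neq_ab.
  pose d := 2 ^ corank ltA b.
  have le_d : d <= 2 ^ M by rewrite leq_exp2l // ltnW // ltn_ord.
  have [up down] := copy_shift N A_P ltA_linear ltA_ext s (Ordinal n_gt0) lt_ab.
  have neq_f i j : f (w i) a <> f (w j) b.
    by case=> eq_ab _; rewrite eq_ab irrA in lt_ab.
  have lt1 := transB _ _ _ (reversed 0 isT) (ltB_ext _ _ _ up (neq_f _ _)).
  have lt2 := transB _ _ _ (reversed d le_d) (ltB_ext _ _ _ down (neq_f _ _)).
  by have := transB _ _ _ lt1 lt2; rewrite irrB.
have lt_f a b : ltA a b -> ltB (f (w 0) a) (f (w 0) b).
  move=> lt_ab; have := ordered (a, b).
  by rewrite /misordered /= lt_ab => /negbFE.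
exists (f (w 0)); split.
- exact: copy_inj.
- move=> i; apply: copy_rels => //.
  + by rewrite size_take_min drop0 size_s; apply/minn_idPl; rewrite leq_addr.
  + by rewrite /w drop0; apply: take_sorted.
  + by rewrite /w drop0; apply/allP => y /mem_take; apply: (allP bnd_s).
move=> a b; apply/idP/idP; last exact: lt_f.
move=> lt_ab; have [eq_ab|/eqP neq_ab] := eqVneq a b.
  by rewrite eq_ab irrB in lt_ab.
have [//|/lt_f lt_ba] := totalA a b neq_ab.
by have := transB _ _ _ lt_ab lt_ba; rewrite irrB.
Qed.
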